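(* $F_e(3,3;4) \leq 860$. That is, there exists a $K_4$-free simple graph on $860$ vertices such that every $2$-coloring of its edges contains a monochromatic triangle.
   Context: For a simple graph $G$, $G \rightarrow (3,3)$ means that every coloring of the edges of $G$ with two colors yields a triangle ($K_3$) all of whose edges have the same color. The edge Folkman number $F_e(3,3;4)$ is the smallest number of vertices of a graph $G$ that contains no $K_4$ (complete graph on 4 vertices) and satisfies $G \rightarrow (3,3)$. *)

(* Defs.v *)
From mathcomp Require Import all_boot.

Set Implicit Arguments.
Unset Strict Implicit.
Unset Printing Implicit Defensive.

Record simple_graph (T : finType) := SimpleGraph {
  adj :> rel T;
  adj_sym : symmetric adj;
  adj_irr : irreflexive adj
}.

Definition is_clique (T : finType) (G : simple_graph T) (K : {set T}) : Prop :=
  {in K &, forall x y, x != y -> G x y}.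

Definition clique_free (k : nat) (T : finType) (G : simple_graph T) : Prop :=
  forall K : {set T}, #|K| = k -> ~ is_clique G K.

(* An edge is the unordered pair [set x; y] of its ends. A colouring is a total
   function on vertex sets, of which only the values at edges are used. *)
Definition monochromatic (T : finType) (c : {set T} -> bool) (K : {set T}) :
    Prop :=
  exists b : bool, {in K &, forall x y, x != y -> c [set x; y] = b}.

Definition arrows33 (T : finType) (G : simple_graph T) : Prop :=
  forall c : {set T} -> bool,
    exists K : {set T}, [/\ #|K| = 3, is_clique G K & monochromatic c K].

Definition has_folkman_graph (n : nat) : Prop :=
  exists (T : finType) (G : simple_graph T),
    [/\ #|T| = n, clique_free 4 G & arrows33 G].

(* [is_Fe334 N] reads "F_e(3,3;4) = N". *)
Definition is_Fe334 (N : nat) : Prop :=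
  has_folkman_graph N /\ forall n : nat, has_folkman_graph n -> N <= n.

(* Main.v *)
Require Import Defs.
From Stdlib Require Import ZArith Reals Lra Lia FMapPositive.

(** The graph is a circulant graph on Z/793, completed by isolated vertices. Give
the two colours the values 1 and -1. If no triangle is monochromatic, then
xy + yz + zx = -1 on each triangle with edges x, y, z, so for any weights W on
the triangles the quadratic form Q = sum W (xy + yz + zx) takes the value
- sum W at the colouring. On the other hand a diagonal matrix D with Q + D >= 0
bounds Q from below by minus the trace of D. The weights are chosen so that the
two bounds contradict each other.

Indexing the edges by midpoint and half difference, Q + D is invariant under
translation of the midpoint, so the Fourier transform splits it into 793 real
quadratic forms in 72 variables, whose coefficients are integer combinations of
the cosines of 2 pi k / 793. Multiplication by 216, of order 20 modulo 793,
preserves the graph and the weights and permutes the forms, which leaves 43 of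
them. Each is proved nonnegative by a Cholesky decomposition in integers, after
rounding the cosines to multiples of 2^-13. *)

(** * Cosines of the multiples of 2 pi / 793 *)

Section Trigonometry.
Local Open Scope R_scope.

Definition angle (n k : Z) : R := 2 * PI * IZR k / IZR n.

Lemma angleD n a b : angle n (a + b) = angle n a + angle n b.
Proof. unfold angle; rewrite plus_IZR; unfold Rdiv; ring. Qed.

Lemma angle_mod n k : (0 < n)%Z -> (0 <= k)%Z ->
  angle n k = angle n (k mod n) + 2 * INR (Z.to_nat (k / n)) * PI.
Proof.
intros n0 k0; rewrite (Z.div_mod k n) at 1 by lia.
rewrite Z.add_comm, angleD; f_equal.
rewrite INR_IZR_INZ, Z2Nat.id by (apply Z.div_pos; lia).
unfold angle; rewrite mult_IZR; field; apply not_0_IZR; lia.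
Qed.

Lemma cos_angle_mod n k : (0 < n)%Z -> (0 <= k)%Z ->
  cos (angle n (k mod n)) = cos (angle n k).
Proof. intros n0 k0; rewrite (angle_mod n k n0 k0); now rewrite cos_period. Qed.

Lemma sin_angle_mod n k : (0 < n)%Z -> (0 <= k)%Z ->
  sin (angle n (k mod n)) = sin (angle n k).
Proof. intros n0 k0; rewrite (angle_mod n k n0 k0); now rewrite sin_period. Qed.

Lemma angle_opp n k : (0 < n)%Z -> angle n (n - k) = - angle n k + 2 * INR 1 * PI.
Proof.
intros n0; unfold angle; rewrite minus_IZR; simpl; field.
apply not_0_IZR; lia.
Qed.

Lemma cos_angle_opp n k : (0 < n)%Z -> cos (angle n (n - k)) = cos (angle n k).
Proof. intros n0; rewrite (angle_opp n k n0), cos_period; apply cos_neg. Qed.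

Lemma sin_angle_opp n k : (0 < n)%Z -> sin (angle n (n - k)) = - sin (angle n k).
Proof. intros n0; rewrite (angle_opp n k n0), sin_period; apply sin_neg. Qed.

(** Half the angle lies strictly between 0 and pi, where the sine is positive, and cos 2x = 1 - 2
    sin^2 x. *)
Lemma cos_angle_lt1 n k : (0 < k < n)%Z -> cos (angle n k) < 1.
Proof.
intros kn.
assert (n0 : 0 < IZR n) by (apply IZR_lt; lia).
assert (k0 : 0 < IZR k) by (apply IZR_lt; lia).
assert (k1 : IZR k < IZR n) by (apply IZR_lt; lia).
assert (q0 : 0 < IZR k / IZR n) by (apply Rdiv_lt_0_compat; lra).
assert (q1 : IZR k / IZR n < 1) by (apply Rmult_lt_reg_r with (IZR n); [lra|];
  unfold Rdiv; rewrite Rmult_assoc, Rinv_l; lra).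
assert (P := PI_RGT_0).
assert (S0 : 0 < sin (PI * (IZR k / IZR n))) by (apply sin_gt_0; nra).
replace (angle n k) with (2 * (PI * (IZR k / IZR n))) by (unfold angle; field; lra).
rewrite cos_2a_sin; nra.
Qed.

(** The alternating series of pi / 4 = 2 arctan (1/3) + arctan (1/7), cut after ten terms for the
    lower bound and after nine for the upper. *)
Lemma PI_bounds : 3.1415926530 < PI < 3.1415926540.
Proof.
assert (H := PI_2_3_7_ineq 4).
unfold PI_2_3_7_tg, tg_alt, Ratan_seq in H; simpl in H; lra.
Qed.

(* [cos1] and [sin1] are 2^40 times the cosine and sine of 2 pi / 793. *)
Definition cos1 : Z := 1099477114918.
Definition sin1 : Z := 8711680985.

Lemma angle1_bounds : 0.007923310600252 < angle 793 1 < 0.007923310602775.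
Proof. unfold angle; assert (H := PI_bounds); lra. Qed.

(* [(c, s)] runs through 2^40 times the points of angle 2 pi k / 793, with
   error at most [e] in each coordinate; the table [f] has scale 2^13. *)
Fixpoint cos_check (f : Z -> Z) (n : nat) (k c s e : Z) : bool :=
  match n with
  | O => true
  | S n' =>
      ((Z.abs (c - 2 ^ 27 * f k) + e <=? 2 ^ 27)
       && cos_check f n' (k + 1) ((c * cos1 - s * sin1) / 2 ^ 40)
            ((s * cos1 + c * sin1) / 2 ^ 40) (e + e / 64 + 150))%Z%bool
  end.

(** The lower bound goes to degree 6 because at the angle 2 pi / 793 the term a^4 / 24 is about 180
    units of 2^-40, more than the error 64 of [cos1_bound]. *)
Lemma cos_poly_bounds a : 0 <= a <= 1 ->
  1 - a ^ 2 / 2 + a ^ 4 / 24 - a ^ 6 / 720 <= cos a <= 1 - a ^ 2 / 2 + a ^ 4 / 24.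
Proof.
intros a01.
destruct (pre_cos_bound a 1) as [L _]; [lra | lra |].
destruct (pre_cos_bound a 0) as [_ U]; [lra | lra |].
unfold cos_approx, cos_term in L, U.
cbn [sum_f_R0 Nat.mul Nat.add] in L, U; rewrite !INR_IZR_INZ in L, U.
change (Z.of_nat (fact 6)) with 720%Z in L.
change (Z.of_nat (fact 4)) with 24%Z in L, U.
change (Z.of_nat (fact 2)) with 2%Z in L, U.
change (Z.of_nat (fact 0)) with 1%Z in L, U.
simpl in *; lra.
Qed.

Lemma sin_poly_bounds a : 0 <= a <= 1 ->
  a - a ^ 3 / 6 <= sin a <= a - a ^ 3 / 6 + a ^ 5 / 120.
Proof.
intros a01.
destruct (pre_sin_bound a 0) as [L U]; [lra | lra |].
unfold sin_approx, sin_term in L, U.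
cbn [sum_f_R0 Nat.mul Nat.add] in L, U; rewrite !INR_IZR_INZ in L, U.
change (Z.of_nat (fact 5)) with 120%Z in U.
change (Z.of_nat (fact 3)) with 6%Z in L, U.
change (Z.of_nat (fact 1)) with 1%Z in L, U.
simpl in *; lra.
Qed.

Lemma cos1_bound : Rabs (2 ^ 40 * cos (angle 793 1) - IZR cos1) <= 64.
Proof.
assert (A := angle1_bounds); set (a := angle 793 1) in *.
assert (B := cos_poly_bounds a ltac:(lra)).
assert (a2l : 0.007923310600252 ^ 2 <= a ^ 2) by (apply pow_incr; lra).
assert (a2u : a ^ 2 <= 0.007923310602775 ^ 2) by (apply pow_incr; lra).
assert (a4l : 0.007923310600252 ^ 4 <= a ^ 4) by (apply pow_incr; lra).
assert (a4u : a ^ 4 <= 0.007923310602775 ^ 4) by (apply pow_incr; lra).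
assert (a6u : a ^ 6 <= 0.007923310602775 ^ 6) by (apply pow_incr; lra).
unfold cos1; apply Rabs_le; lra.
Qed.

Lemma sin1_bound : Rabs (2 ^ 40 * sin (angle 793 1) - IZR sin1) <= 64.
Proof.
assert (A := angle1_bounds); set (a := angle 793 1) in *.
assert (B := sin_poly_bounds a ltac:(lra)).
assert (a3l : 0.007923310600252 ^ 3 <= a ^ 3) by (apply pow_incr; lra).
assert (a3u : a ^ 3 <= 0.007923310602775 ^ 3) by (apply pow_incr; lra).
assert (a5u : a ^ 5 <= 0.007923310602775 ^ 5) by (apply pow_incr; lra).
unfold sin1; apply Rabs_le; lra.
Qed.

Lemma Rabs_le_bounds x a : Rabs x <= a -> - a <= x <= a.
Proof. unfold Rabs; destruct (Rcase_abs x); lra. Qed.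

Lemma IZR_div_bounds (a b : Z) : (0 < b)%Z ->
  IZR a / IZR b - 1 <= IZR (a / b) <= IZR a / IZR b.
Proof.
intros b0; assert (B : 0 < IZR b) by (apply IZR_lt; lia).
assert (E : IZR a / IZR b = IZR (a / b) + IZR (a mod b) / IZR b).
  rewrite (Z.div_mod a b) at 1 by lia; rewrite plus_IZR, mult_IZR; field; lra.
assert (M := Z.mod_pos_bound a b b0).
assert (0 <= IZR (a mod b) / IZR b).
  apply Rmult_le_pos; [apply IZR_le; lia | apply Rlt_le, Rinv_0_lt_compat; lra].
assert (IZR (a mod b) / IZR b <= 1).
  apply Rmult_le_reg_r with (IZR b); [lra|].
  unfold Rdiv; rewrite Rmult_assoc, Rinv_l by lra.
  rewrite Rmult_1_l, Rmult_1_r; apply IZR_le; lia.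
lra.
Qed.

(** If p and q are the errors of a and b, the error of the product is p y + x q - p q / X. The
    factor [Rabs y] is kept because it will be small when y is the sine of 2 pi / 793. *)
Lemma prod_error (X x y a b e d : R) : 0 < X -> 0 <= e -> 0 <= d ->
  Rabs x <= 1 -> Rabs (X * x - a) <= e -> Rabs (X * y - b) <= d ->
  Rabs (X * (x * y) - a * b / X) <= e * Rabs y + d + e * d / X.
Proof.
intros X0 e0 d0 x1 Ha Hb.
replace (X * (x * y) - a * b / X) with
  ((X * x - a) * y + x * (X * y - b) - (X * x - a) * (X * y - b) / X)
  by (field; lra).
set (p := X * x - a) in *; set (q := X * y - b) in *.
assert (H1 : Rabs (p * y) <= e * Rabs y).
  rewrite Rabs_mult; apply Rmult_le_compat_r; [apply Rabs_pos | exact Ha].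
assert (H2 : Rabs (x * q) <= d).
  rewrite Rabs_mult; replace d with (1 * d) by ring.
  apply Rmult_le_compat; auto using Rabs_pos.
assert (H3 : Rabs (p * q / X) <= e * d / X).
  unfold Rdiv; rewrite !Rabs_mult, (Rabs_right (/ X)).
  apply Rmult_le_compat_r; [apply Rlt_le, Rinv_0_lt_compat; lra|].
  apply Rmult_le_compat; auto using Rabs_pos.
  apply Rle_ge, Rlt_le, Rinv_0_lt_compat; lra.
eapply Rle_trans; [apply Rabs_triang|]; rewrite Rabs_Ropp.
eapply Rle_trans; [apply Rplus_le_compat_r, Rabs_triang|]; lra.
Qed.


Lemma sin_angle1 : Rabs (sin (angle 793 1)) <= 1 / 100.
Proof.
assert (H := sin1_bound); unfold sin1 in H.
apply Rabs_le_bounds in H; apply Rabs_le; lra.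
Qed.

(** The sign [sg] covers the addition formulas of cosine and sine alike. In the increment, e / 64
    absorbs e / 100 from the sine factor and the second-order terms, and 150 absorbs the errors 64
    of [cos1] and [sin1] and the two floors. *)
Lemma rotation_error (u v : R) (c s r e : Z) (sg : R) :
  (sg = 1 \/ sg = -1) -> (0 <= e)%Z -> Rabs u <= 1 -> Rabs v <= 1 ->
  Rabs (2 ^ 40 * u - IZR c) <= IZR e -> Rabs (2 ^ 40 * v - IZR s) <= IZR e ->
  IZR r = IZR c * IZR cos1 + sg * (IZR s * IZR sin1) ->
  Rabs (2 ^ 40 * (u * cos (angle 793 1) + sg * (v * sin (angle 793 1)))
        - IZR (r / 2 ^ 40)) <= IZR (e + e / 64 + 150).
Proof.
intros Hsg e0 u1 v1 Hc Hs Hr.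
assert (e0' : 0 <= IZR e) by (apply IZR_le; lia).
assert (C1 := prod_error (2 ^ 40) _ _ _ _ _ 64 ltac:(lra) e0' ltac:(lra) u1 Hc cos1_bound).
assert (S1 := prod_error (2 ^ 40) _ _ _ _ _ 64 ltac:(lra) e0' ltac:(lra) v1 Hs sin1_bound).
assert (E := IZR_div_bounds r (2 ^ 40) eq_refl).
assert (E64 := IZR_div_bounds e 64 eq_refl).
rewrite !plus_IZR.
assert (cle : IZR e * Rabs (cos (angle 793 1)) <= IZR e).
  rewrite <- (Rmult_1_r (IZR e)) at 2; apply Rmult_le_compat_l; auto.
  apply Rabs_le, COS_bound.
assert (sle : IZR e * Rabs (sin (angle 793 1)) <= IZR e * (1 / 100)).
  apply Rmult_le_compat_l; auto; apply sin_angle1.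
rewrite Hr in E; change (IZR (2 ^ 40)) with 1099511627776 in E.
replace (2 ^ 40) with 1099511627776 in * by ring.
apply Rabs_le_bounds in C1; apply Rabs_le_bounds in S1; apply Rabs_le.
destruct Hsg as [-> | ->]; lra.
Qed.

Lemma cos_check_sound f n k c s e : (0 <= e)%Z ->
  Rabs (2 ^ 40 * cos (angle 793 k) - IZR c) <= IZR e ->
  Rabs (2 ^ 40 * sin (angle 793 k) - IZR s) <= IZR e ->
  cos_check f n k c s e = true ->
  forall i, (k <= i < k + Z.of_nat n)%Z ->
  Rabs (2 ^ 13 * cos (angle 793 i) - IZR (f i)) <= 1.
Proof.
revert k c s e; induction n as [|n IH]; intros k c s e e0 Hc Hs; [simpl; lia|].
cbn [cos_check]; intros H i Hi.
apply andb_prop in H; destruct H as [H1 H2].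
destruct (Z.eq_dec i k) as [->|nik].
- apply Z.leb_le in H1; apply IZR_le in H1.
  rewrite plus_IZR, abs_IZR, minus_IZR, mult_IZR in H1.
  change (IZR (2 ^ 27)) with 134217728 in H1.
  apply Rmult_le_reg_l with 134217728; [lra|].
  rewrite <- (Rabs_right 134217728) at 1 by lra.
  rewrite <- Rabs_mult.
  replace (134217728 * (2 ^ 13 * cos (angle 793 k) - IZR (f k))) with
    ((2 ^ 40 * cos (angle 793 k) - IZR c) + (IZR c - 134217728 * IZR (f k))) by ring.
  eapply Rle_trans; [apply Rabs_triang|]; lra.
- assert (eq0 : (0 <= e / 64)%Z) by (apply Z.div_pos; lia).
  refine (IH _ _ _ _ _ _ _ H2 i _); [lia | | | lia]; clear IH H1 H2 nik Hi i.
  + rewrite angleD, cos_plus.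
    replace (cos (angle 793 k) * cos (angle 793 1) - sin (angle 793 k) * sin (angle 793 1))
      with (cos (angle 793 k) * cos (angle 793 1)
            + -1 * (sin (angle 793 k) * sin (angle 793 1))) by ring.
    apply rotation_error with c s; auto.
    * apply Rabs_le, COS_bound.
    * apply Rabs_le, SIN_bound.
    * rewrite minus_IZR, !mult_IZR; ring.
  + rewrite angleD, sin_plus.
    replace (sin (angle 793 k) * cos (angle 793 1) + cos (angle 793 k) * sin (angle 793 1))
      with (sin (angle 793 k) * cos (angle 793 1)
            + 1 * (cos (angle 793 k) * sin (angle 793 1))) by ring.
    apply rotation_error with s c; auto.
    * apply Rabs_le, SIN_bound.
    * apply Rabs_le, COS_bound.
    * rewrite plus_IZR, !mult_IZR; ring.
Qed.

Lemma cos_check_sound0 f n : cos_check f n 0 (2 ^ 40) 0 0 = true ->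
  forall i, (0 <= i < Z.of_nat n)%Z ->
  Rabs (8192 * cos (angle 793 i) - IZR (f i)) <= 1.
Proof.
intros H i Hi; replace 8192 with (2 ^ 13) by ring.
assert (A0 : angle 793 0 = 0) by (unfold angle; field).
refine (cos_check_sound _ _ _ _ _ _ (Z.le_refl 0) _ _ H i _); [| | lia];
  rewrite A0, ?cos_0, ?sin_0.
- rewrite Rmult_1_r; change (IZR (2 ^ 40)) with 1099511627776.
  replace (2 ^ 40) with 1099511627776 by ring; rewrite Rminus_diag, Rabs_R0; lra.
- rewrite Rmult_0_r, Rminus_diag, Rabs_R0; lra.
Qed.

End Trigonometry.

From mathcomp Require Import all_boot all_order all_algebra.
From mathcomp Require Import ssrZ Rstruct ring lra.

Set Implicit Arguments.
Unset Strict Implicit.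
Unset Printing Implicit Defensive.

Import Order.TTheory GRing.Theory Num.Theory.

Delimit Scope Z_scope with zz.

(** * Fourier analysis of translation invariant forms *)

Section Fourier.
Local Open Scope ring_scope.
Variables (R : realFieldType) (A : finComNzRingType) (C S : A -> R).
Hypothesis CD : forall a b, C (a + b) = C a * C b - S a * S b.
Hypothesis CN : forall a, C (- a) = C a.
Hypothesis SN : forall a, S (- a) = - S a.
Hypothesis sumC : forall a : A, \sum_(j : A) C (j * a) = if a == 0 then #|A|%:R else 0.

(** Real and imaginary part of the Fourier transform. The ring product [j * m] pairs frequencies
    with positions, so frequencies range over [A] as well. *)
Definition fourC (x : A -> R) (j : A) := \sum_m x m * C (j * m).
Definition fourS (x : A -> R) (j : A) := \sum_m x m * S (j * m).

(** This is the real part of one transform times the conjugate of the other. *)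
Lemma fourCS_mul (x z : A -> R) (j : A) :
  fourC x j * fourC z j + fourS x j * fourS z j
  = \sum_m \sum_m' x m * z m' * C (j * (m - m')).
Proof.
rewrite /fourC /fourS !big_distrlr /= -big_split /=; apply: eq_bigr => m _.
rewrite -big_split /=; apply: eq_bigr => m' _.
by rewrite mulrBr CD CN SN; ring.
Qed.

Lemma sum_C_mul (u v : A) :
  (\sum_j C (j * u) * C (j * v)) *+ 2
  = #|A|%:R * ((u + v == 0)%:R + (u - v == 0)%:R).
Proof.
have -> : (\sum_j C (j * u) * C (j * v)) *+ 2
    = \sum_j C (j * (u + v)) + \sum_j C (j * (u - v)).
  rewrite -sumrMnl -big_split; apply: eq_bigr => j _ /=.
  rewrite mulrDr mulrBr !CD CN SN; ring.
by rewrite !sumC; case: (_ + _ == 0); case: (_ - _ == 0) => /=; ring.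
Qed.

(** By the orthogonality in [sum_C_mul], the factor [C (j * u)] leaves only pairs of positions that
    differ by u; both signs occur because the cosine is even. *)
Lemma parseval_shift (x z : A -> R) (u : A) :
  (\sum_j C (j * u) * (fourC x j * fourC z j + fourS x j * fourS z j)) *+ 2
  = #|A|%:R * \sum_m x m * (z (m + u) + z (m - u)).
Proof.
under eq_bigr => j _ do rewrite fourCS_mul big_distrr /=.
rewrite exchange_big /= -sumrMnl big_distrr /=; apply: eq_bigr => m _.
under eq_bigr => j _ do rewrite big_distrr /=.
rewrite exchange_big /= -sumrMnl.
transitivity (\sum_m' x m * z m' * (#|A|%:R
    * ((m' == m + u)%:R + (m' == m - u)%:R))).
  apply: eq_bigr => m' _.
  have -> : \sum_j C (j * u) * (x m * z m' * C (j * (m - m')))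
      = x m * z m' * \sum_j C (j * u) * C (j * (m - m')).
    by rewrite big_distrr; apply: eq_bigr => j _ /=; ring.
  rewrite -mulrnAr sum_C_mul; congr (_ * (_ * (_%:R + _%:R))); congr nat_of_bool.
    by rewrite addrA [u + m]addrC subr_eq0 eq_sym.
  by rewrite subr_eq0 eq_sym subr_eq [RHS]eq_sym subr_eq addrC.
under eq_bigr => m' _ do rewrite mulrCA mulrDr.
rewrite -big_distrr big_split /=; congr (_ * _).
rewrite mulrDr; congr (_ + _).
- rewrite (bigD1 (m + u)) //= eqxx mulr1 big1 ?addr0 // => i /negbTE ->.
  by rewrite mulr0.
- rewrite (bigD1 (m - u)) //= eqxx mulr1 big1 ?addr0 // => i /negbTE ->.
  by rewrite mulr0.
Qed.

Lemma parseval (x : A -> R) :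
  \sum_j (fourC x j ^+ 2 + fourS x j ^+ 2) = #|A|%:R * \sum_m x m ^+ 2.
Proof.
(* At 0 all summands of [sumC] equal [C 0], and there are as many of them as elements of [A]. *)
have C0 : C 0 = 1.
  have := sumC 0; rewrite eqxx.
  under eq_bigr => j _ do rewrite mulr0.
  rewrite sumr_const cardT -cardE => e.
  have n0 : #|A|%:R != 0 :> R by rewrite pnatr_eq0 -lt0n; apply/card_gt0P; exists 0.
  by apply: (mulIf n0); rewrite mul1r mulr_natr.
have := parseval_shift x x 0.
under eq_bigr => j _ do rewrite mulr0 C0 mul1r -!expr2.
under [in RHS]eq_bigr => m _ do rewrite subr0 addr0 -mulr2n mulrnAr -expr2.
rewrite sumrMnl mulrnAr -[LHS]mulr_natr -[RHS]mulr_natr => e.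
by apply: mulIf e; rewrite pnatr_eq0.
Qed.

(* [y h m] stands for the colour of the edge {m - h, m + h}, and the triangle
   {m - h, m + h, m + h + 2 k} has the edges (h, m), (k, m + h + k) and
   (h + k, m + k). *)
Section TriangleForm.
Variables (W : A -> A -> R) (D : A -> R) (y : A -> A -> R).
Hypothesis WN : forall h k, W (- h) (- k) = W h k.
Hypothesis Wsym : forall h k, W k h = W h k.
Hypothesis Wrot : forall h k, W (- h) (h + k) = W h k.
Hypothesis form_ge0 : forall (j : A) (a : A -> R), (forall h, a (- h) = a h) ->
  0 <= \sum_h \sum_k W h k * C (j * (h + k)) * (a h * a k)
       + \sum_h D h * a h ^+ 2.
Hypothesis yN : forall h m, y (- h) m = y h m.
Hypothesis y_sqr : forall h m, y h m ^+ 2 = 1.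

Let F := \sum_h \sum_k \sum_m W h k * (y h m * y k (m + (h + k))).

Lemma triangle_form_opp :
  F = \sum_h \sum_k \sum_m W h k * (y h m * y k (m - (h + k))).
Proof.
rewrite /F (reindex_inj oppr_inj); apply: eq_bigr => h _ /=.
rewrite (reindex_inj oppr_inj); apply: eq_bigr => k _ /=.
by apply: eq_bigr => m _; rewrite WN !yN opprD.
Qed.

(** [parseval_shift] involves both shifts by [h + k] and [- (h + k)]. Adding to [F] its reflected
    copy from [triangle_form_opp] supplies both, so the identity is proved after doubling. *)
Lemma triangle_form_fourier :
  #|A|%:R * F = \sum_j (
    \sum_h \sum_k W h k * C (j * (h + k)) * (fourC (y h) j * fourC (y k) j) +
    \sum_h \sum_k W h k * C (j * (h + k)) * (fourS (y h) j * fourS (y k) j)).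
Proof.
apply: (@mulIf _ 2%:R); first by rewrite pnatr_eq0.
rewrite mulr_natr mulr2n -mulrDr {1}/F triangle_form_opp -big_split /=.
rewrite big_distrr /= mulr_natr -sumrMnl.
transitivity (\sum_h \sum_k W h k * (#|A|%:R *
   \sum_m y h m * (y k (m + (h + k)) + y k (m - (h + k))))).
  apply: eq_bigr => h _; rewrite -big_split /= big_distrr /=.
  apply: eq_bigr => k _; rewrite -big_split /= [RHS]mulrCA; congr (_ * _).
  by rewrite big_distrr; apply: eq_bigr => m _ /=; ring.
under eq_bigr => h _ do under eq_bigr => k _ do rewrite -parseval_shift.
transitivity (\sum_h \sum_j \sum_k (W h k * C (j * (h + k)) *
   (fourC (y h) j * fourC (y k) j + fourS (y h) j * fourS (y k) j)) *+ 2).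
  apply: eq_bigr => h _; rewrite exchange_big /=; apply: eq_bigr => k _.
  by rewrite mulrnAr big_distrr -sumrMnl; apply: eq_bigr => j _ /=; rewrite mulrA.
rewrite exchange_big /=; apply: eq_bigr => j _.
rewrite -big_split -sumrMnl; apply: eq_bigr => h _ /=.
by rewrite -big_split -sumrMnl; apply: eq_bigr => k _ /=; rewrite mulrDr.
Qed.

(** At each frequency [form_ge0] is applied to the real and to the imaginary parts, which are even
    in h because [y] is. Since [y] has square 1, Parseval turns the diagonal part into the trace. *)
Lemma triangle_form_ge : - (#|A|%:R * \sum_h D h) <= F.
Proof.
have A0 : 0 < #|A|%:R :> R by rewrite ltr0n; apply/card_gt0P; exists 0.
rewrite -(ler_pM2l A0) triangle_form_fourier -subr_ge0 mulrN opprK.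
have -> : #|A|%:R * (#|A|%:R * \sum_h D h)
  = \sum_j (\sum_h D h * fourC (y h) j ^+ 2 + \sum_h D h * fourS (y h) j ^+ 2).
  under [RHS]eq_bigr => j _ do rewrite -big_split /=.
  rewrite [RHS]exchange_big /= !big_distrr /=; apply: eq_bigr => h _.
  under [RHS]eq_bigr => j _ do rewrite -mulrDr.
  rewrite -big_distrr /= parseval.
  under eq_bigr => m _ do rewrite y_sqr.
  by rewrite sumr_const; ring.
rewrite -big_split /=; apply: sumr_ge0 => j _; rewrite addrACA.
by apply: addr_ge0; apply: form_ge0 => h; apply: eq_bigr => m _; rewrite yN.
Qed.

(** [F] contains one of the three products of edges in each triangle, and the symmetries of [W] show
    that the other two have the same sum. Hence 3 [F] is minus [#|A|] times the total weight, which
    is compared with [triangle_form_ge]. *)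
Lemma weight_le_of_not_mono :
  (forall h k m, W h k != 0 ->
     y h m * y k (m + (h + k)) + y h m * y (h + k) (m + k)
     + y k (m + (h + k)) * y (h + k) (m + k) = -1) ->
  \sum_h \sum_k W h k <= 3%:R * \sum_h D h.
Proof.
move=> tri.
(* The substitution of (-h, h + k) for (h, k) exchanges the first two vertices of the triangle. *)
have F2 : F = \sum_h \sum_k \sum_m W h k * (y h m * y (h + k) (m + k)).
  rewrite /F (reindex_inj oppr_inj); apply: eq_bigr => h _ /=.
  rewrite (reindex_inj (addrI h)); apply: eq_bigr => k _ /=.
  by apply: eq_bigr => m _; rewrite Wrot yN addKr.
(* The substitution of (-k, -h) for (h, k), with midpoint m + h + k, lists the vertices in reverse
   order. *)
have F3 : F = \sum_h \sum_k \sum_m W h k *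
    (y k (m + (h + k)) * y (h + k) (m + k)).
  rewrite F2 [RHS]exchange_big (reindex_inj oppr_inj).
  apply: eq_bigr => h _ /=.
  rewrite (reindex_inj oppr_inj); apply: eq_bigr => k _ /=.
  rewrite [RHS](reindex_inj (addIr (- (k + h)))); apply: eq_bigr => m _ /=.
  have -> : m - (k + h) + h = m - k by rewrite opprD addrA subrK.
  by rewrite WN yN -opprD yN Wsym subrK [k + h]addrC.
have sumF : F *+ 3 = \sum_h \sum_k \sum_(m : A) - W h k.
  rewrite mulrS mulr2n addrA {2}F2 {2}F3 /F -!big_split /=.
  apply: eq_bigr => h _; rewrite -!big_split /=.
  apply: eq_bigr => k _; rewrite -!big_split /=.
  apply: eq_bigr => m _.
  have [->|W0] := eqVneq (W h k) 0; first by rewrite !mul0r oppr0 !addr0.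
  transitivity (W h k * -1); last by rewrite mulrN1.
  by rewrite -(tri h k m W0) !mulrDr.
have A0 : 0 < #|A|%:R :> R by rewrite ltr0n; apply/card_gt0P; exists 0.
rewrite -(ler_pM2l A0).
have -> : #|A|%:R * (\sum_h \sum_k W h k) = - (F *+ 3).
  rewrite sumF big_distrr -sumrN /=; apply: eq_bigr => h _.
  rewrite big_distrr -sumrN /=; apply: eq_bigr => k _.
  by rewrite sumr_const mulNrn opprK mulr_natl.
by have := triangle_form_ge; rewrite -mulr_natr; lra.
Qed.
End TriangleForm.
End Fourier.

(** * Positivity of quadratic forms with integer coefficients *)

Section RoundedCholesky.
Local Open Scope Z_scope.

Definition zsum (l : seq Z) : Z := foldr Z.add 0 l.

Fixpoint upper (B : Type) (f : Z -> Z -> B) (l : seq Z) : seq (seq B) :=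
  if l is h :: l' then (f h h :: map (f h) l') :: upper f l' else [::].

Fixpoint add_diag (ds : seq Z) (rows : seq (seq Z)) : seq (seq Z) :=
  match ds, rows with
  | d :: ds', (a :: r) :: rows' => (a + d :: r) :: add_diag ds' rows'
  | _, _ => rows
  end.

Fixpoint sub_scaled (c : Z) (g row : seq Z) : seq Z :=
  match g, row with
  | b :: g', a :: row' => a - c * b :: sub_scaled c g' row'
  | _, _ => row
  end.

(** The matrix A - g g^T - diag(rho) in triangular storage. Each row starts at its diagonal entry,
    so [g] loses its head in step with the rows. *)
Fixpoint schur (g rho : seq Z) (rows : seq (seq Z)) : seq (seq Z) :=
  match g, rho, rows with
  | c :: g', r :: rho', row :: rows' =>
      (if sub_scaled c g row is a :: row' then a - r :: row' else [::])
      :: schur g' rho' rows'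
  | _, _, _ => rows
  end.

(* One step subtracts the square of the linear form [c x + g . xs], where
   [c] is below the square root of the pivot [d] and [g] is [v / c] rounded.
   The rounding residues [rho] are exact and are paid for by diagonal
   dominance, out of the later diagonal entries and out of [d - c * c]; the
   term [n / 6] makes that last reserve large enough. *)
Fixpoint psd_check (n : nat) (rows : seq (seq Z)) : bool :=
  match rows, n with
  | [::], _ => true
  | (d :: v) :: rows', n'.+1 =>
      let c := Z.sqrt d - Z.of_nat n / 6 - 1 in
      let g := map (fun a => (a + c / 2) / c) v in
      let rho := map (fun ab => Z.abs (ab.1 - c * ab.2)) (zip v g) in
      if 0 <? c then
        if zsum rho <=? d - c * c then psd_check n' (schur g rho rows')
        else false
      else false
  | _, _ => false
  end.

End RoundedCholesky.

Fixpoint triangular (B : Type) (rows : seq (seq B)) : bool :=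
  if rows is r :: rows' then (size r == (size rows').+1) && triangular rows'
  else true.

Section CholeskySound.
Local Open Scope ring_scope.
Variables (R : realFieldType) (zr : Z -> R).
Hypothesis zrD : forall a b, zr (a + b)%zz = zr a + zr b.
Hypothesis zrB : forall a b, zr (a - b)%zz = zr a - zr b.
Hypothesis zrM : forall a b, zr (a * b)%zz = zr a * zr b.
Hypothesis zr_le : forall a b, (a <=? b)%zz -> zr a <= zr b.
Hypothesis zr_abs : forall a, zr (Z.abs a) = `|zr a|.
Hypothesis zr0 : zr 0 = 0.

Fixpoint dot (v : seq Z) (xs : seq R) : R :=
  match v, xs with a :: v', x :: xs' => zr a * x + dot v' xs' | _, _ => 0 end.

Fixpoint sqdot (v : seq Z) (xs : seq R) : R :=
  match v, xs with a :: v', x :: xs' => zr a * x ^+ 2 + sqdot v' xs' | _, _ => 0 end.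

(** Only the upper triangle is stored, hence the doubling. Where [xs] ends early, the remaining
    variables count as 0. *)
Fixpoint qform (rows : seq (seq Z)) (xs : seq R) : R :=
  match rows, xs with
  | (d :: v) :: rows', x :: xs' =>
      zr d * x ^+ 2 + x * dot v xs' *+ 2 + qform rows' xs'
  | _, _ => 0
  end.

Lemma size_sub_scaled c g row : size (sub_scaled c g row) = size row.
Proof. by elim: g row => [|b g IH] [|a row] //=; rewrite IH. Qed.

Lemma size_schur g rho rows : size (schur g rho rows) = size rows.
Proof. by elim: g rho rows => [|c g IH] [|r rho] [|row rows] //=; rewrite IH. Qed.

Lemma triangular_schur g rho rows :
  triangular rows -> triangular (schur g rho rows).
Proof.
elim: g rho rows => [|c g IH] [|r rho] [|row rows] //= /andP[srow trows].
rewrite IH // size_schur andbT.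
by case: row srow => [|a row] //=; rewrite size_sub_scaled.
Qed.

Lemma dot_sub_scaled c g row xs : size g = size row ->
  dot (sub_scaled c g row) xs = dot row xs - zr c * dot g xs.
Proof.
elim: g row xs => [|b g IH] [|a row] [|x xs] //= sz; try by rewrite mulr0 subr0.
by rewrite IH ?zrB ?zrM; [ring | case: sz].
Qed.

Lemma qform_schur g rho rows xs :
  triangular rows -> size g = size rows -> size rho = size rows ->
  qform (schur g rho rows) xs = qform rows xs - dot g xs ^+ 2 - sqdot rho xs.
Proof.
elim: g rho rows xs => [|c g IH] [|r rho] [|[|a row] rows] [|x xs] //=;
  rewrite ?expr0n ?subr0 //= => /andP[/eqP[srow] trows] [sg] [srho].
by rewrite IH // dot_sub_scaled ?srow // !zrB zrM; ring.
Qed.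

(** A residue t = a - c b satisfies 2 t x y >= - |t| (x^2 + y^2). The share of x^2 is charged to e,
    and the share of y^2 is the entry of [sqdot]. *)
Lemma rounding_ge0 (v g : seq Z) c e x xs : size g = size v ->
  zr (zsum (map (fun ab => Z.abs (ab.1 - c * ab.2)%zz) (zip v g))) <= e ->
  0 <= e * x ^+ 2 + x * (dot v xs - zr c * dot g xs) *+ 2
     + sqdot (map (fun ab => Z.abs (ab.1 - c * ab.2)%zz) (zip v g)) xs.
Proof.
elim: v g e xs => [|a v IH] [|b g] e [|y xs] //= sz.
- by rewrite zr0 => e0; rewrite mulr0 subrr mulr0 mul0rn !addr0 mulr_ge0 ?sqr_ge0.
- by rewrite zr0 => e0; rewrite mulr0 subrr mulr0 mul0rn !addr0 mulr_ge0 ?sqr_ge0.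
- move=> le_e; rewrite mulr0 subrr mulr0 mul0rn !addr0 mulr_ge0 ?sqr_ge0 //.
  apply: le_trans le_e; rewrite -zr0; apply: zr_le; apply/Z.leb_le.
  elim: (zip v g) => [|p l IHl] /=; rewrite /zsum /= ?Z.add_0_r; first exact: Z.abs_nonneg.
  by rewrite Z.add_assoc [X in (X + _)%zz]Z.add_comm -Z.add_assoc;
     apply: Z.add_nonneg_nonneg => //; apply: Z.abs_nonneg.
rewrite zrD zr_abs zrB zrM => le_e; set t := zr a - zr c * zr b.
have {}IH := IH g (e - `|t|) xs.
rewrite -/t lerBrDl in IH.
have sz' : size g = size v by case: sz.
have := IH sz' le_e; set Q := sqdot _ _; set dv := dot v xs; set dg := dot g xs => H.
suff K : 0 <= `|t| * x ^+ 2 + x * (t * y) *+ 2 + `|t| * y ^+ 2.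
  suff -> : e * x ^+ 2 + x * (zr a * y + dv - zr c * (zr b * y + dg)) *+ 2
     + (`|t| * y ^+ 2 + Q)
    = ((e - `|t|) * x ^+ 2 + x * (dv - zr c * dg) *+ 2 + Q)
      + (`|t| * x ^+ 2 + x * (t * y) *+ 2 + `|t| * y ^+ 2) by exact: addr_ge0.
  by rewrite /t; ring.
have [t0|/ltW t0] := leP 0 t; rewrite ?(ger0_norm t0) ?(ler0_norm t0).
  suff -> : t * x ^+ 2 + x * (t * y) *+ 2 + t * y ^+ 2 = t * (x + y) ^+ 2.
    by rewrite mulr_ge0 ?sqr_ge0.
  by ring.
suff -> : - t * x ^+ 2 + x * (t * y) *+ 2 + - t * y ^+ 2 = - t * (x - y) ^+ 2.
  by rewrite mulr_ge0 ?sqr_ge0 // oppr_ge0.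
by ring.
Qed.

(** Completing the square: the form is (c x + g . xs)^2, plus the form of the matrix given by
    [schur], plus the expression of [rounding_ge0] with e = d - c^2. *)
Lemma psd_check_sound n rows xs :
  triangular rows -> psd_check n rows -> 0 <= qform rows xs.
Proof.
elim: n rows xs => [|n IH] [|[|d v] rows] [|x xs] //= /andP[/eqP[sv] trows].
set c := (_ - _ - 1)%zz; set g := map _ v; set rho := map _ (zip v g).
case: ifP => // _; case: ifP => // le_rho chk.
have sg : size g = size v by rewrite size_map.
have srho : size rho = size v by rewrite size_map size_zip sg minnn.
have H1 := IH _ xs (triangular_schur g rho trows) chk.
rewrite qform_schur ?sg ?srho // in H1.
have H2 := @rounding_ge0 v g c (zr (d - c * c)%zz) x xs sg (zr_le le_rho).
rewrite -/rho zrB zrM in H2.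
have := addr_ge0 (addr_ge0 H1 H2) (sqr_ge0 (zr c * x + dot g xs)).
by congr (0 <= _); ring.
Qed.

Lemma triangular_upper (B : Type) (f : Z -> Z -> B) l : triangular (upper f l).
Proof.
elim: l => //= h l ->; rewrite andbT size_map eqSS; apply/eqP.
by elim: l => //= k l ->.
Qed.

Lemma map_upper (B B' : Type) (e : B -> B') (f : Z -> Z -> B) l :
  map (map e) (upper f l) = upper (fun h k => e (f h k)) l.
Proof. by elim: l => //= h l ->; rewrite -map_comp. Qed.

Lemma triangular_add_diag ds rows :
  triangular rows -> triangular (add_diag ds rows).
Proof.
have sz ds' rows' : size (add_diag ds' rows') = size rows'.
  by elim: ds' rows' => [|d ds' IH] [|[|a r] rows'] //=; rewrite IH.
elim: ds rows => [|d ds IH] [|[|a r] rows] //= /andP[sr tr].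
by rewrite sz sr IH.
Qed.

Lemma dot_map (f : Z -> Z) (a : Z -> R) l :
  dot (map f l) (map a l) = \sum_(k <- l) zr (f k) * a k.
Proof. by elim: l => [|k l IH] /=; rewrite ?big_nil ?big_cons ?IH. Qed.

Lemma qform_upper (f : Z -> Z -> Z) (ds : Z -> Z) (a : Z -> R) l :
  (forall h k, h \in l -> k \in l -> f h k = f k h) ->
  qform (add_diag (map ds l) (upper f l)) (map a l)
  = \sum_(h <- l) \sum_(k <- l) zr (f h k) * (a h * a k)
    + \sum_(h <- l) zr (ds h) * a h ^+ 2.
Proof.
elim: l => [|h l IH] fsym /=; first by rewrite !big_nil addr0.
rewrite IH => [|h' k' h'l k'l]; last by apply: fsym; rewrite inE (h'l, k'l) orbT.
rewrite dot_map !big_cons zrD.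
have -> : \sum_(h' <- l) \sum_(k <- h :: l) zr (f h' k) * (a h' * a k)
  = a h * (\sum_(k <- l) zr (f h k) * a k)
    + \sum_(h' <- l) \sum_(k <- l) zr (f h' k) * (a h' * a k).
  rewrite big_distrr -big_split; apply: eq_big_seq => h' h'l /=.
  rewrite big_cons (fsym h' h) ?inE ?h'l ?eqxx ?orbT //.
  by congr (_ + _); ring.
have -> : \sum_(k <- l) zr (f h k) * (a h * a k)
  = a h * (\sum_(k <- l) zr (f h k) * a k).
  by rewrite big_distrr; apply: eq_bigr => k _ /=; ring.
by ring.
Qed.

End CholeskySound.

(** * The graph and the weights *)

Section Certificate.
Local Open Scope Z_scope.

Definition modulus : Z := 793.
Definition multiplier : Z := 216.

(* Representatives up to sign of the set of [h] such that 0 and [2 h] are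
   adjacent; it is a union of orbits of the group generated by [multiplier],
   which contains -1. The integers attached to the orbits of edges and
   triangles below are a rounded solution of the semidefinite program that
   maximises the total weight. *)
Definition half_diffs : seq Z := [::
  24; 28; 29; 34; 38; 40; 48; 50; 53; 56; 59; 60; 61; 70; 79; 80; 81; 83;
  88; 94; 100; 102; 119; 125; 135; 146; 155; 158; 162; 166; 171; 172; 174;
  176; 181; 184; 189; 194; 197; 199; 201; 203; 206; 207; 220; 229; 233; 239;
  270; 271; 272; 278; 296; 297; 298; 302; 304; 305; 311; 313; 314; 315; 328;
  335; 346; 362; 367; 369; 374; 381; 382; 389].

Definition diag_orbits : seq (Z * Z) := [::
  (24, 2218); (29, 1631); (34, 1949); (38, 2199); (40, 1887); (48, 1860);
  (61, 1139); (94, 2869)].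

Definition weight_orbits : seq (Z * Z * Z) := [::
  (24, 24, 562); (24, 29, 342); (24, 56, 339); (24, 59, 201); (24, 70, 370);
  (24, 272, 383); (24, 304, 470); (24, 311, 368); (29, 155, 316);
  (29, 172, 395); (29, 174, 426); (29, 382, 331); (34, 60, 360);
  (34, 155, 321); (34, 271, 326); (38, 56, 478); (38, 146, 402);
  (38, 201, 426); (38, 374, 339); (40, 79, 390); (40, 189, 324)].

Definition frequencies : seq Z := [::
  0; 1; 2; 3; 4; 5; 6; 8; 9; 10; 12; 13; 15; 16; 17; 18; 19; 20; 23; 24; 26;
  29; 31; 32; 34; 36; 38; 40; 43; 45; 47; 48; 52; 57; 58; 61; 72; 76; 93;
  94; 122; 144; 244].

Definition cos_table : seq Z := [::
  8192; 8192; 8191; 8190; 8188; 8186; 8183; 8179; 8176; 8171; 8166; 8161;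
  8155; 8149; 8142; 8134; 8126; 8118; 8109; 8099; 8089; 8079; 8068; 8056;
  8044; 8032; 8019; 8005; 7991; 7977; 7962; 7946; 7930; 7914; 7897; 7879;
  7861; 7842; 7823; 7804; 7784; 7764; 7743; 7721; 7699; 7677; 7654; 7631;
  7607; 7582; 7558; 7532; 7506; 7480; 7454; 7426; 7399; 7371; 7342; 7313;
  7284; 7254; 7223; 7192; 7161; 7129; 7097; 7065; 7031; 6998; 6964; 6930;
  6895; 6859; 6824; 6788; 6751; 6714; 6677; 6639; 6601; 6562; 6523; 6483;
  6444; 6403; 6363; 6322; 6280; 6238; 6196; 6153; 6110; 6067; 6023; 5979;
  5934; 5889; 5844; 5798; 5752; 5706; 5659; 5612; 5565; 5517; 5469; 5420;
  5371; 5322; 5273; 5223; 5173; 5122; 5071; 5020; 4969; 4917; 4865; 4813;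
  4760; 4707; 4654; 4600; 4546; 4492; 4438; 4383; 4328; 4273; 4217; 4161;
  4105; 4049; 3993; 3936; 3879; 3821; 3764; 3706; 3648; 3590; 3531; 3473;
  3414; 3355; 3295; 3236; 3176; 3116; 3056; 2996; 2935; 2875; 2814; 2753;
  2691; 2630; 2568; 2507; 2445; 2383; 2321; 2258; 2196; 2133; 2071; 2008;
  1945; 1882; 1818; 1755; 1692; 1628; 1564; 1501; 1437; 1373; 1309; 1245;
  1180; 1116; 1052; 987; 923; 858; 794; 729; 665; 600; 535; 470; 406; 341;
  276; 211; 146; 81; 16; -49; -114; -178; -243; -308; -373; -438; -503;
  -567; -632; -697; -762; -826; -891; -955; -1020; -1084; -1148; -1213;
  -1277; -1341; -1405; -1469; -1532; -1596; -1660; -1723; -1787; -1850;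
  -1913; -1976; -2039; -2102; -2165; -2227; -2290; -2352; -2414; -2476;
  -2538; -2599; -2661; -2722; -2783; -2844; -2905; -2966; -3026; -3086;
  -3146; -3206; -3266; -3325; -3384; -3443; -3502; -3561; -3619; -3677;
  -3735; -3793; -3850; -3907; -3964; -4021; -4077; -4133; -4189; -4245;
  -4300; -4355; -4410; -4465; -4519; -4573; -4627; -4680; -4733; -4786;
  -4839; -4891; -4943; -4994; -5046; -5097; -5147; -5198; -5248; -5297;
  -5347; -5396; -5444; -5493; -5541; -5588; -5636; -5683; -5729; -5775;
  -5821; -5867; -5912; -5957; -6001; -6045; -6089; -6132; -6175; -6217;
  -6259; -6301; -6342; -6383; -6424; -6464; -6503; -6543; -6581; -6620;
  -6658; -6695; -6733; -6769; -6806; -6842; -6877; -6912; -6947; -6981;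
  -7015; -7048; -7081; -7113; -7145; -7177; -7208; -7239; -7269; -7298;
  -7328; -7356; -7385; -7413; -7440; -7467; -7493; -7519; -7545; -7570;
  -7595; -7619; -7642; -7665; -7688; -7710; -7732; -7753; -7774; -7794;
  -7814; -7833; -7852; -7870; -7888; -7905; -7922; -7938; -7954; -7969;
  -7984; -7998; -8012; -8025; -8038; -8050; -8062; -8073; -8084; -8094;
  -8104; -8113; -8122; -8130; -8138; -8145; -8152; -8158; -8164; -8169;
  -8173; -8178; -8181; -8184; -8187; -8189; -8190; -8191; -8192].

Definition flatmap (I B : Type) (f : I -> seq B) (s : seq I) : seq B :=
  flatten (map f s).

Definition addm (a b : Z) : Z :=
  let s := a + b in if s <? modulus then s else s - modulus.
Definition oppm (a : Z) : Z := if a =? 0 then 0 else modulus - a.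
Definition subm (a b : Z) : Z := addm a (oppm b).
Definition mulm (a b : Z) : Z := (a * b) mod modulus.

Definition key (x : Z) : positive := Z.to_pos (x + 1).
Definition lookup (t : PositiveMap.t Z) (x : Z) : Z :=
  match PositiveMap.find (key x) t with Some v => v | None => 0 end.
Definition store (t : PositiveMap.t Z) (xs : seq (Z * Z)) : PositiveMap.t Z :=
  foldl (fun t xv => PositiveMap.add (key xv.1) xv.2 t) t xs.

(** Ten steps are taken throughout: 216^10 = -1 modulo 793, so negation reaches the rest of an
    orbit. *)
Fixpoint orbit (n : nat) (x : Z) : seq Z :=
  if n is n'.+1 then x :: orbit n' (mulm multiplier x) else [::].

Fixpoint zrange (n : nat) (x : Z) : seq Z :=
  if n is n'.+1 then x :: zrange n' (x + 1) else [::].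

Definition diag_map : PositiveMap.t Z :=
  store (PositiveMap.empty Z)
    (flatmap (fun sd => flatmap (fun x => [:: (x, sd.2); (oppm x, sd.2)])
       (orbit 10 sd.1)) diag_orbits).
Definition diag (x : Z) : Z := lookup diag_map x.
(** The values in [diag_orbits] are nonzero and [lookup] defaults to 0, so the support of [diag]
    serves as the connection set. *)
Definition is_half_diff (x : Z) : bool := ~~ (diag x =? 0).

Definition all_half_diffs : seq Z := half_diffs ++ map oppm half_diffs.

(** Injective on pairs of residues, as 1024 exceeds 793. *)
Definition pair_key (h k : Z) : Z := 1024 * h + k.
(** The orbit of (s, t) under the three symmetries [WN], [Wsym] and [Wrot] required of the
    weights. *)
Definition pair_images (s t w : Z) : seq (Z * Z) :=
  let u := addm s t in
  flatmap (fun hk => let (h, k) := hk : Z * Z in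
     [:: (pair_key h k, w); (pair_key k h, w);
      (pair_key (oppm h) (oppm k), w); (pair_key (oppm k) (oppm h), w)])
   [:: (s, t); (oppm s, u); (oppm t, u)].
Definition weight_map : PositiveMap.t Z :=
  store (PositiveMap.empty Z)
    (flatmap (fun stw => let '(s, t, w) := stw in
       flatmap (fun xy => pair_images xy.1 xy.2 w)
         (zip (orbit 10 s) (orbit 10 t))) weight_orbits).
Definition weight (h k : Z) : Z :=
  if is_half_diff h && is_half_diff k && is_half_diff (addm h k)
  then lookup weight_map (pair_key h k) else 0.

Definition cos_map : PositiveMap.t Z :=
  store (PositiveMap.empty Z)
    (flatmap (fun kv => [:: kv; (oppm kv.1, kv.2)])
       (zip (zrange 397 0) cos_table)).
Definition cosz (x : Z) : Z := lookup cos_map x.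

(** The table covers 0 to 396 and evenness gives the rest. In 397 steps the error bound of
    [cos_check] stays below 2^23, small against the 2^27 that one unit of the table is worth. *)
Definition cosz_check : bool :=
  all (fun x => cosz (oppm x) =? cosz x) (zrange 793 0)
  && cos_check cosz 397 0 (2 ^ 40) 0 0.

Definition diag_check : bool :=
  all (fun x => eqb (is_half_diff x) (has (Z.eqb x) all_half_diffs)
     && (diag (oppm x) =? diag x) && (diag (mulm multiplier x) =? diag x))
    (zrange 793 0).

Definition weight_check : bool :=
  all (fun h => all (fun k =>
    if is_half_diff (addm h k) then
      let w := weight h k in
      (weight k h =? w) && (weight (oppm h) (oppm k) =? w)
      && (weight (oppm h) (addm h k) =? w)
      && (weight (mulm multiplier h) (mulm multiplier k) =? w)
    else true) all_half_diffs) all_half_diffs.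

(** A clique of size 4 can be translated to contain 0; x, y and z are the halves of its other
    vertices. *)
Definition clique_check : bool :=
  all (fun x =>
    let nb := filter (fun y => is_half_diff (subm y x)) all_half_diffs in
    all (fun y => all (fun z => ~~ (is_half_diff (subm z y))) nb) nb)
   all_half_diffs.

(** The strict inequality that contradicts [weight_le_of_not_mono]. *)
Definition sum_check : bool :=
  3 * zsum (map diag all_half_diffs) <?
  zsum (map (fun h => zsum (map (weight h) all_half_diffs)) all_half_diffs).

Definition cover_check : bool :=
  let l := flatmap (fun j => flatmap (fun x => [:: x; oppm x]) (orbit 10 j))
             frequencies in
  all (fun x => has (Z.eqb x) l) (zrange 793 0).

(** The variables at k and -k coincide, so their coefficients are merged. The list does not depend
    on the frequency and is shared by all forms; [eval_terms] inserts the cosines. *)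
Definition terms (h k : Z) : seq (Z * Z) :=
  let term k' := let w := weight h k' in
    if w =? 0 then [::] else [:: (w, addm h k')] in
  term k ++ term (oppm k).
Definition eval_terms (j : Z) (ts : seq (Z * Z)) : Z :=
  zsum (map (fun wu => wu.1 * cosz (mulm j wu.2)) ts).

(** A cosine scaled by 8192 is off by at most 1 in the table, so the sum subtracted here bounds the
    total error of row h. Diagonal dominance pays for that error. *)
Definition margin (h : Z) : Z :=
  8192 * diag h
  - zsum (map (fun k => Z.abs (weight h k) + Z.abs (weight h (oppm k))) half_diffs).

Definition forms_check (js : seq Z) : bool :=
  let ts := upper terms half_diffs in
  let ds := map margin half_diffs in
  all (fun j => psd_check 72 (add_diag ds (map (map (eval_terms j)) ts))) js.


(** * Evaluation of the checks *)

Lemma cosz_checkT : cosz_check.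
Proof. vm_cast_no_check (erefl true). Qed.

Lemma diag_checkT : diag_check.
Proof. vm_cast_no_check (erefl true). Qed.

Lemma weight_checkT : weight_check.
Proof. vm_cast_no_check (erefl true). Qed.

Lemma clique_checkT : clique_check.
Proof. vm_cast_no_check (erefl true). Qed.

Lemma sum_checkT : sum_check.
Proof. vm_cast_no_check (erefl true). Qed.

Lemma cover_checkT : cover_check.
Proof. vm_cast_no_check (erefl true). Qed.

Lemma uniq_half_diffs : uniq all_half_diffs.
Proof. vm_cast_no_check (erefl true). Qed.

Lemma forms_checkT : forms_check frequencies.
Proof. vm_cast_no_check (erefl true). Qed.

End Certificate.

(** * Arrowing *)

(* Without this, unification and [done] run the checks. *)
Opaque half_diffs frequencies diag_orbits weight_orbits cos_table.

Lemma Zof_nat_modn m d : (0 < d)%N ->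
  Z.of_nat (m %% d) = (Z.of_nat m mod Z.of_nat d)%zz.
Proof.
move=> d0; apply: (Z.mod_unique_pos _ _ (Z.of_nat (m %/ d))).
  by have /ssrnat.ltP := ltn_pmod m d0; lia.
rewrite {1}(divn_eq m d) -plusE -multE; lia.
Qed.

Lemma all_zrange (f : Z -> bool) n x y :
  all f (zrange n x) -> (x <= y < x + Z.of_nat n)%zz -> f y.
Proof.
elim: n x => [|n IH] x /=; first lia.
move=> /andP[fx alln] xy; case: (Z.eq_dec x y) => [<-//|nxy].
apply: IH alln _; lia.
Qed.

Lemma forms_checkP js j : forms_check js -> j \in js ->
  psd_check 72 (add_diag (map margin half_diffs)
    (upper (fun h k => eval_terms j (terms h k)) half_diffs)).
Proof.
move=> chk jin; rewrite -(map_upper (eval_terms j)).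
by move: chk; rewrite /forms_check => /allP; apply.
Qed.

(** Symmetry of [e] splits each row sum evenly between both variables. A pair then contributes (e -
    E) / 4 times (a - b)^2 plus (e + E) / 4 times (a + b)^2, with nonnegative coefficients. *)
Lemma diag_dominant (R : realFieldType) (I : eqType) (l : seq I)
    (E e : I -> I -> R) (a : I -> R) :
  (forall h k, `|E h k| <= e h k)%R -> (forall h k, e h k = e k h) ->
  (0 <= \sum_(h <- l) \sum_(k <- l) E h k * (a h * a k)
        + \sum_(h <- l) (\sum_(k <- l) e h k) * a h ^+ 2)%R.
Proof.
move=> Ee esym.
have -> : (\sum_(h <- l) (\sum_(k <- l) e h k) * a h ^+ 2
    = \sum_(h <- l) \sum_(k <- l) e h k * ((a h ^+ 2 + a k ^+ 2) / 2%:R))%R.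
  apply: (@mulIf _ 2%:R); first by rewrite pnatr_eq0.
  rewrite mulr_natr mulr2n.
  have {2}-> : (\sum_(h <- l) (\sum_(k <- l) e h k) * a h ^+ 2
      = \sum_(h <- l) \sum_(k <- l) e h k * a k ^+ 2)%R.
    rewrite [RHS]exchange_big; apply: eq_bigr => h _ /=; rewrite big_distrl.
    by apply: eq_bigr => k _ /=; rewrite esym.
  rewrite -big_split big_distrl; apply: eq_bigr => h _ /=.
  rewrite !big_distrl -big_split; apply: eq_bigr => k _ /=; by field.
rewrite -big_split; apply: sumr_ge0 => h _ /=; rewrite -big_split.
apply: sumr_ge0 => k _ /=.
have := Ee h k; rewrite ler_norml => /andP[E1 E2].
have -> : (E h k * (a h * a k) + e h k * ((a h ^+ 2 + a k ^+ 2) / 2%:R)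
  = (e h k - E h k) / 4%:R * (a h - a k) ^+ 2
    + (e h k + E h k) / 4%:R * (a h + a k) ^+ 2)%R by field.
by rewrite addr_ge0 // mulr_ge0 ?sqr_ge0 ?mulr_ge0 ?invr_ge0 ?ler0n //; lra.
Qed.

Lemma scaled_error (F : comNzRingType) (c w w' x x' z z' : F) :
  (c * (w * x + w' * x') - (w * z + w' * z')
   = w * (c * x - z) + w' * (c * x' - z'))%R.
Proof. by ring. Qed.

Lemma IZR_abs z : IZR (Z.abs z) = `|IZR z|%R.
Proof. by rewrite abs_IZR RabsE. Qed.

Lemma IZR_leb a b : (a <=? b)%zz -> (IZR a <= IZR b)%R.
Proof. by move/Z.leb_le => ab; apply/RleP; apply: IZR_le. Qed.

Lemma IZR_zsum (I : Type) (f : I -> Z) (l : seq I) :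
  IZR (zsum (map f l)) = (\sum_(i <- l) IZR (f i))%R.
Proof.
elim: l => [|i l IH]; first by rewrite big_nil.
by rewrite big_cons -IH; apply: plus_IZR.
Qed.

(* 397 is the inverse of 2 modulo 793; the vertices from 793 on are isolated. *)
Definition folkman_adj (u v : 'I_860) : bool :=
  [&& (u < 793)%N, (v < 793)%N &
      is_half_diff (mulm 397 (subm (Z.of_nat u) (Z.of_nat v)))].

(** * The ring of residues modulo 793 and the transfer of the integer checks to it *)

Section Residues.
(** With [p] a variable, ['I_p.+2] is a nontrivial ring whose size is known through [pE] alone; the
    value 791 enters only at the end. *)
Variable p : nat.
Hypothesis pE : Z.of_nat p.+2 = modulus.
Local Open Scope ring_scope.
Local Notation A := 'I_p.+2.

Definition zv (a : A) : Z := Z.of_nat a.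
Definition zinv (x : Z) : A := inord (Z.to_nat x).

Lemma zv_range a : (0 <= zv a < modulus)%zz.
Proof. by rewrite -pE /zv; have /ssrnat.ltP := ltn_ord a; lia. Qed.

Lemma zv_inj : injective zv.
Proof. by move=> a b /Nat2Z.inj /val_inj. Qed.

Lemma zvK : cancel zv zinv.
Proof. by move=> a; rewrite /zinv /zv Nat2Z.id inord_val. Qed.

Lemma zinvK x : (0 <= x < modulus)%zz -> zv (zinv x) = x.
Proof.
move=> x_mod; rewrite /zv /zinv inordK ?Z2Nat.id //; first lia.
by apply/ssrnat.ltP; move: x_mod pE; lia.
Qed.

Lemma zvM a b : zv (a * b) = mulm (zv a) (zv b).
Proof. by rewrite /zv /= Zof_nat_modn // pE /mulm -Nat2Z.inj_mul. Qed.

Lemma zvD a b : zv (a + b) = addm (zv a) (zv b).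
Proof.
have := zv_range a; have := zv_range b.
rewrite /zv /= Zof_nat_modn // pE /addm -plusE Nat2Z.inj_add => hb ha.
case: Z.ltb_spec => h; first by rewrite Z.mod_small //; lia.
rewrite -[LHS](Z.mod_unique_pos _ _ 1 (Z.of_nat a + Z.of_nat b - modulus)) //; lia.
Qed.

Lemma zvN a : zv (- a) = oppm (zv a).
Proof.
have := zv_range a; rewrite /zv /= Zof_nat_modn // pE /oppm -minusE => ha.
rewrite Nat2Z.inj_sub; last by move: ha pE; lia.
rewrite pE; case: Z.eqb_spec => [->|h]; first by rewrite Z.sub_0_r Z_mod_same_full.
by rewrite Z.mod_small //; lia.
Qed.

Lemma zvB a b : zv (a - b) = subm (zv a) (zv b).
Proof. by rewrite zvD zvN. Qed.

Lemma all_zv (f : Z -> bool) a : all f (zrange 793 0) -> f (zv a).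
Proof. by move/all_zrange; apply; have := zv_range a. Qed.

Definition hdiff (a : A) : bool := is_half_diff (zv a).
Definition zgen : A := zinv multiplier.
Definition inv2 : A := zinv 397.

Lemma zv_zgen : zv zgen = multiplier. Proof. by rewrite zinvK. Qed.

Lemma inv2D : inv2 + inv2 = 1.
Proof. by apply: zv_inj; rewrite zvD zinvK. Qed.

Lemma inv2M a : inv2 * (a + a) = a.
Proof. by rewrite mulrDr -mulrDl inv2D mul1r. Qed.

Lemma zgen_inj : injective ( *%R zgen).
Proof.
(* 525 is the inverse of 216 modulo 793. *)
have h : zinv 525 * zgen = 1.
  by apply: zv_inj; rewrite zvM zv_zgen zinvK.
by apply: (can_inj (g := *%R (zinv 525))) => a; rewrite mulrA h mul1r.
Qed.

Lemma diagP a : [/\ hdiff a = has (Z.eqb (zv a)) all_half_diffs,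
  diag (zv (- a)) = diag (zv a) & diag (zv (zgen * a)) = diag (zv a)].
Proof.
have /(all_zv a) /andP[/andP[/eqP e /Z.eqb_eq e2] /Z.eqb_eq e3] := diag_checkT.
by split => //; rewrite ?zvN ?zvM ?zv_zgen.
Qed.

Lemma hdiffE a : hdiff a = (zv a \in all_half_diffs).
Proof.
have [-> _ _] := diagP a; rewrite -has_pred1; apply: eq_has => x /=.
by rewrite eq_sym.
Qed.

Lemma hdiffN a : hdiff (- a) = hdiff a.
Proof. by rewrite /hdiff /is_half_diff; have [_ -> _] := diagP a. Qed.

Lemma hdiff_gen a : hdiff (zgen * a) = hdiff a.
Proof. by rewrite /hdiff /is_half_diff; have [_ _ ->] := diagP a. Qed.

Lemma hdiff0 : hdiff 0 = false.
Proof. by rewrite hdiffE; vm_compute. Qed.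

Definition Wz (h k : A) : Z := weight (zv h) (zv k).

Lemma Wz_supp h k : ~~ [&& hdiff h, hdiff k & hdiff (h + k)] -> Wz h k = 0%zz.
Proof.
by rewrite /Wz /weight -zvD -!/(hdiff _) andbA => /negbTE ->.
Qed.

(** If one of the three edges is missing, all sides vanish, because that condition has the same
    symmetries. Otherwise [weight_check] decides. *)
Lemma WzP h k : [/\ Wz k h = Wz h k, Wz (- h) (- k) = Wz h k,
  Wz (- h) (h + k) = Wz h k & Wz (zgen * h) (zgen * k) = Wz h k].
Proof.
case: (boolP [&& hdiff h, hdiff k & hdiff (h + k)]) => [/and3P[Th Tk Thk]|nT]; last first.
  rewrite (Wz_supp nT) !Wz_supp //.
  - by rewrite -mulrDr !hdiff_gen.
  - by rewrite addKr hdiffN; apply: contra nT => /and3P[-> -> ->].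
  - by rewrite -opprD !hdiffN.
  - by rewrite addrC; apply: contra nT => /and3P[-> -> ->].
have /allP/(_ (zv h)) := weight_checkT; rewrite -hdiffE => /(_ Th).
move=> /allP/(_ (zv k)); rewrite -hdiffE => /(_ Tk).
rewrite -zvD -/(hdiff (h + k)) Thk -!zvN -zv_zgen -!zvM -!/(Wz _ _).
by move=> /andP[/andP[/andP[/Z.eqb_eq -> /Z.eqb_eq ->] /Z.eqb_eq ->] /Z.eqb_eq ->].
Qed.

Lemma Wz_sym h k : Wz k h = Wz h k. Proof. by have [] := WzP h k. Qed.
Lemma WzN h k : Wz (- h) (- k) = Wz h k. Proof. by have [] := WzP h k. Qed.
Lemma Wz_rot h k : Wz (- h) (h + k) = Wz h k. Proof. by have [] := WzP h k. Qed.
Lemma Wz_gen h k : Wz (zgen * h) (zgen * k) = Wz h k.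
Proof. by have [] := WzP h k. Qed.

(** * The characters of Z/793 and the accuracy of their table *)

Definition chC (a : A) : R := cos (angle modulus (zv a)).
Definition chS (a : A) : R := sin (angle modulus (zv a)).

Lemma angle_zvD (f : R -> R) a b :
  (forall k, (0 <= k)%zz ->
     f (angle modulus (k mod modulus)%zz) = f (angle modulus k)) ->
  f (angle modulus (zv (a + b))) = f (angle modulus (zv a) + angle modulus (zv b)).
Proof.
move=> fmod; rewrite {1}/zv /= Zof_nat_modn // pE -plusE Nat2Z.inj_add fmod; last lia.
by rewrite angleD.
Qed.

Lemma chCD a b : chC (a + b) = chC a * chC b - chS a * chS b.
Proof.
rewrite /chC (angle_zvD (f := cos)); first exact: cos_plus.
by move=> k k0; apply: cos_angle_mod.
Qed.

Lemma chSD a b : chS (a + b) = chS a * chC b + chC a * chS b.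
Proof.
rewrite /chS (angle_zvD (f := sin)); first exact: sin_plus.
by move=> k k0; apply: sin_angle_mod.
Qed.

Lemma angle0 n : angle n 0 = 0%R.
Proof. by rewrite /angle /Rdiv !RmultE mulr0 mul0r. Qed.

Lemma zvN_eq a : zv (- a) = (modulus - zv a)%zz \/ (zv (- a) = 0%zz /\ zv a = 0%zz).
Proof.
rewrite zvN /oppm; case: Z.eqb_spec => h; [by right | by left].
Qed.

Lemma chCN a : chC (- a) = chC a.
Proof.
rewrite /chC; case: (zvN_eq a) => [->|[-> ->]] //.
exact: cos_angle_opp.
Qed.

Lemma chSN a : chS (- a) = - chS a.
Proof.
rewrite /chS; case: (zvN_eq a) => [->|[-> ->]]; first exact: sin_angle_opp.
by rewrite angle0 sin_0 oppr0.
Qed.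

Lemma chC_neq1 a : a != 0 -> chC a != 1.
Proof.
move=> a0; apply/eqP => c1.
have : Rlt (chC a) 1.
  apply: cos_angle_lt1; have := zv_range a.
  suff : zv a <> 0%zz by lia.
  by rewrite -[0%zz]/(zv 0) => /zv_inj a0'; rewrite a0' eqxx in a0.
by rewrite c1 => /RltP; rewrite ltxx.
Qed.

Lemma chC0 : chC 0 = 1.
Proof. by rewrite /chC angle0 cos_0. Qed.

Lemma sum_chC (a : A) : \sum_(j : A) chC (j * a) = if a == 0 then #|A|%:R else 0.
Proof.
have [->|a0] := eqVneq a 0.
  under eq_bigr => j _ do rewrite mulr0 chC0.
  by rewrite sumr_const.
(* (X, Y) is fixed by the rotation through the angle of a, which is not 0. *)
set X := LHS; pose Y := \sum_(j : A) chS (j * a).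
have eX : X = X * chC a - Y * chS a.
  rewrite {1}/X (reindex_inj (addIr 1)) /= /X /Y !big_distrl -sumrB /=.
  by apply: eq_bigr => j _; rewrite mulrDl mul1r chCD.
have eY : Y = Y * chC a + X * chS a.
  rewrite {1}/Y (reindex_inj (addIr 1)) /= /X /Y !big_distrl -big_split /=.
  by apply: eq_bigr => j _; rewrite mulrDl mul1r chSD.
have : ((1 - chC a) ^+ 2 + chS a ^+ 2) * X = 0.
  transitivity ((1 - chC a) * (X - X * chC a) + X * chS a * chS a); first by ring.
  rewrite {1}eX.
  transitivity (- chS a * (Y - Y * chC a - X * chS a)); first by ring.
  by rewrite {1}eY; ring.
move/eqP; rewrite mulf_eq0 => /orP[|/eqP //].
rewrite paddr_eq0 ?sqr_ge0 // sqrf_eq0 subr_eq0 eq_sym.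
by rewrite (negbTE (chC_neq1 a0)).
Qed.

Lemma cosz_bound a : `|IZR 8192 * chC a - IZR (cosz (zv a))| <= 1.
Proof.
have /andP[evn chk] := cosz_checkT.
have small b : (zv b < 397)%zz -> `|IZR 8192 * chC b - IZR (cosz (zv b))| <= 1.
  move=> b397; have b0 := zv_range b.
  by have /RleP := cos_check_sound0 cosz 397 chk (zv b) ltac:(lia); rewrite RabsE.
case: (Z.ltb_spec (zv a) 397) => ha; first exact: small.
have := all_zv a evn => /Z.eqb_eq <-; rewrite -zvN -chCN; apply: small.
clear evn chk; have := zv_range a; rewrite zvN /oppm /modulus.
by case: Z.eqb_spec => [->|_] ar; lia.
Qed.


(** * Nonnegativity of the forms at all frequencies *)

Definition hdiff_reps : seq A := locked (map zinv half_diffs).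

Lemma zv_hdiff_reps : map zv hdiff_reps = half_diffs.
Proof.
rewrite /hdiff_reps -lock -map_comp -[RHS]map_id; apply/eq_in_map => x xl /=; apply: zinvK.
have /allP/(_ x xl) : all (fun x => (0 <=? x)%zz && (x <? modulus)%zz) half_diffs.
  by vm_compute.
by move=> /andP[/Z.leb_le ? /Z.ltb_lt ?].
Qed.

(** By [uniq_half_diffs] the representatives and their negatives list the support without
    repetition. *)
Lemma sum_half (f : A -> R) : (forall h, ~~ hdiff h -> f h = 0) ->
  \sum_h f h = \sum_(h <- hdiff_reps) (f h + f (- h)).
Proof.
move=> f0; transitivity (\sum_(h | hdiff h) f h).
  by rewrite [RHS]big_mkcond; apply: eq_bigr => h _; case: ifPn => // /f0.
have zl : map zv (hdiff_reps ++ map -%R hdiff_reps) = all_half_diffs.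
  rewrite map_cat zv_hdiff_reps /all_half_diffs; congr (_ ++ _).
  by rewrite -zv_hdiff_reps -!map_comp; apply: eq_map => h /=; rewrite zvN.
have peq : perm_eq [seq h <- index_enum A | hdiff h] (hdiff_reps ++ map -%R hdiff_reps).
  apply: uniq_perm.
  - by rewrite filter_uniq ?index_enum_uniq.
  - by apply: (@map_uniq _ _ zv); rewrite zl uniq_half_diffs.
  - move=> h; rewrite mem_filter mem_index_enum andbT hdiffE -zl mem_map //.
    exact: zv_inj.
have splitE (l : seq A) :
    \sum_(h <- l ++ map -%R l) f h = \sum_(h <- l) (f h + f (- h)).
  by rewrite big_cat /= big_map [RHS]big_split.
by rewrite -big_filter (perm_big _ peq) splitE.
Qed.

Definition Wr (h k : A) : R := IZR (Wz h k).
Definition Dr (h : A) : R := IZR (diag (zv h)).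

Definition form (j : A) (a : A -> R) : R :=
  \sum_h \sum_k Wr h k * chC (j * (h + k)) * (a h * a k) + \sum_h Dr h * a h ^+ 2.

Definition half_entry (j h k : A) : R :=
  Wr h k * chC (j * (h + k)) + Wr h (- k) * chC (j * (h - k)).

(** On even functions h and -h share one variable, which leaves 72 of them. The terms at (h, k) and
    (-h, -k) agree, hence the factor 2 and the two summands of [half_entry]. *)
Lemma form_half j a : (forall h, a (- h) = a h) ->
  form j a = (\sum_(h <- hdiff_reps) \sum_(k <- hdiff_reps) half_entry j h k * (a h * a k)
              + \sum_(h <- hdiff_reps) Dr h * a h ^+ 2) *+ 2.
Proof.
move=> aN; rewrite /form mulrnDl; congr (_ + _); last first.
  rewrite sum_half => [|h]; last first.
    by rewrite /hdiff /is_half_diff /Dr negbK => /Z.eqb_eq ->; rewrite mul0r.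
  rewrite -sumrMnl; apply: eq_bigr => h _.
  by rewrite aN /Dr; have [_ -> _] := diagP h; rewrite mulr2n.
pose G h k := Wr h k * chC (j * (h + k)) * (a h * a k).
have GN h k : G (- h) (- k) = G h k.
  by rewrite /G /Wr WzN -opprD mulrN chCN !aN.
have G0 h k : ~~ (hdiff h && hdiff k) -> G h k = 0.
  move=> nT; rewrite /G /Wr Wz_supp ?mul0r //.
  by apply: contra nT => /and3P[-> ->].
rewrite -[LHS]/(\sum_h \sum_k G h k).
transitivity (\sum_h \sum_(k <- hdiff_reps) (G h k + G h (- k))).
  apply: eq_bigr => h _; apply: sum_half => k nTk.
  by apply: G0; rewrite (negbTE nTk) andbF.
rewrite sum_half => [|h nTh]; last first.
  by apply: big1 => k _; rewrite !G0 ?addr0 // (negbTE nTh).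
rewrite -sumrMnl; apply: eq_bigr => h _.
rewrite -big_split -sumrMnl; apply: eq_bigr => k _ /=.
rewrite GN -[in G (- h) k](opprK k) GN [G h (- k) + _]addrC -mulr2n; congr (_ *+ 2).
by rewrite /G /half_entry aN mulrDl.
Qed.

Lemma eval_termsE j h k :
  eval_terms (zv j) (terms (zv h) (zv k))
  = (Wz h k * cosz (zv (j * (h + k))%R)
     + Wz h (- k)%R * cosz (zv (j * (h - k))%R))%zz.
Proof.
rewrite /eval_terms /terms -zvN -!/(Wz _ _) -!zvD.
case: Z.eqb_spec => [->|_]; case: Z.eqb_spec => [->|_];
  rewrite /= /zsum /= ?zvM; lia.
Qed.

Lemma coszN a : cosz (zv (- a)) = cosz (zv a).
Proof. by have /andP[/(all_zv a)/Z.eqb_eq + _] := cosz_checkT; rewrite zvN. Qed.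

(** 8192 times the halved form is a sum of two nonnegative parts: the integer form with diagonal
    [margin], by the Cholesky check, and the rounding errors together with what [margin] withholds,
    by [diag_dominant]. *)
Lemma form_frequency j a : zv j \in frequencies ->
  (forall h, a (- h) = a h) -> 0 <= form j a.
Proof.
move=> jf aN; rewrite form_half // pmulrn_lge0 //.
have chk := forms_checkP forms_checkT jf.
have tri : triangular (add_diag (map margin half_diffs)
    (upper (fun h k => eval_terms (zv j) (terms h k)) half_diffs)).
  by apply/triangular_add_diag/triangular_upper.
have := psd_check_sound plus_IZR minus_IZR mult_IZR IZR_leb IZR_abs (erefl _)
  (map (fun x => a (zinv x)) half_diffs) tri chk.
clear chk tri jf; rewrite (qform_upper plus_IZR); last first.
  move=> x y; rewrite -!zv_hdiff_reps => /mapP[h _ ->] /mapP[k _ ->].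
  rewrite !eval_termsE Wz_sym [h + k]addrC -[in RHS]opprB mulrN coszN.
  by congr (_ + _ * _)%zz; rewrite -WzN opprK Wz_sym.
pose fz h k := IZR (eval_terms (zv j) (terms (zv h) (zv k))).
pose e h k := `|Wr h k| + `|Wr h (- k)|.
have fzE h k : fz h k = Wr h k * IZR (cosz (zv (j * (h + k))))
    + Wr h (- k) * IZR (cosz (zv (j * (h - k)))).
  by rewrite /fz eval_termsE plus_IZR !mult_IZR.
have marginE h : IZR (margin (zv h)) = IZR 8192 * Dr h - \sum_(k <- hdiff_reps) e h k.
  rewrite /margin minus_IZR mult_IZR IZR_zsum -zv_hdiff_reps big_map.
  congr (_ - _); apply: eq_bigr => k _.
  by rewrite plus_IZR !IZR_abs -zvN.
have esym h k : e h k = e k h.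
  rewrite /e /Wr Wz_sym; congr (_ + `|IZR _|).
  by rewrite -WzN opprK Wz_sym.
have entry_err h k : `|IZR 8192 * half_entry j h k - fz h k| <= e h k.
  have -> : IZR 8192 * half_entry j h k - fz h k =
    Wr h k * (IZR 8192 * chC (j * (h + k)) - IZR (cosz (zv (j * (h + k)))))
    + Wr h (- k) * (IZR 8192 * chC (j * (h - k)) - IZR (cosz (zv (j * (h - k))))).
    by rewrite fzE; apply: scaled_error.
  apply: le_trans (ler_normD _ _) _; rewrite !normrM.
  by apply: lerD; apply: ler_piMr; rewrite ?normr_ge0 ?cosz_bound.
have DD := diag_dominant hdiff_reps a entry_err esym.
rewrite -zv_hdiff_reps !big_map => H1.
have H2 : 0 <= \sum_(h <- hdiff_reps) \sum_(k <- hdiff_reps) fz h k * (a h * a k)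
    + \sum_(h <- hdiff_reps) (IZR 8192 * Dr h - \sum_(k <- hdiff_reps) e h k) * a h ^+ 2.
  apply: le_trans H1 _; rewrite le_eqVlt; apply/orP; left; apply/eqP.
  congr (_ + _); apply: eq_bigr => h _.
    by rewrite big_map; apply: eq_bigr => k _; rewrite !zvK.
  by rewrite zvK marginE.
have c0 : 0 < IZR 8192 :> R by apply/RltP; apply: IZR_lt.
rewrite -(pmulr_rge0 _ c0); have := addr_ge0 DD H2; congr (0 <= _).
rewrite addrACA [RHS]mulrDr; congr (_ + _).
  rewrite -big_split big_distrr; apply: eq_bigr => h _ /=.
  rewrite -big_split big_distrr; apply: eq_bigr => k _ /=.
  by rewrite -mulrDl subrK [RHS]mulrA.
rewrite -big_split big_distrr; apply: eq_bigr => h _ /=.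
by rewrite -mulrDl addrC subrK [RHS]mulrA.
Qed.

(** Weights and diagonal are invariant under [zgen], so reindexing by it identifies the form of [a]
    at [zgen * j] with the form of [a \o ginv] at [j]. *)
Lemma form_gen j : (forall a, (forall h, a (- h) = a h) -> 0 <= form j a) ->
  forall a, (forall h, a (- h) = a h) -> 0 <= form (zgen * j) a.
Proof.
move=> jP a aN; have [ginv genK invK] := injF_bij zgen_inj.
have ginvN h : ginv (- h) = - ginv h.
  by apply: zgen_inj; rewrite mulrN !invK.
have := jP (a \o ginv); rewrite /comp /= => /(_ _)/le_trans; apply.
  by move=> h; rewrite ginvN.
rewrite le_eqVlt /form; apply/orP; left; apply/eqP.
congr (_ + _); rewrite (reindex_inj zgen_inj) /=.
  apply: eq_bigr => h _; rewrite (reindex_inj zgen_inj); apply: eq_bigr => k _ /=.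
  have -> : j * (zgen * h + zgen * k) = zgen * j * (h + k).
    by rewrite -mulrDr mulrCA mulrA.
  by rewrite !genK /Wr Wz_gen.
apply: eq_bigr => h _; rewrite genK /Dr.
by have [_ _ ->] := diagP h.
Qed.

Lemma form_opp j : (forall a, (forall h, a (- h) = a h) -> 0 <= form j a) ->
  forall a, (forall h, a (- h) = a h) -> 0 <= form (- j) a.
Proof.
move=> jP a aN; have := jP a aN; congr (0 <= _ + _).
by apply: eq_bigr => h _; apply: eq_bigr => k _; rewrite mulNr chCN.
Qed.

(** By [cover_check], j is up to sign a listed frequency times a power of [zgen]. Induction along
    the orbit uses [form_gen], and [form_opp] settles the sign. *)
Lemma form_ge0 j a : (forall h, a (- h) = a h) -> 0 <= form j a.
Proof.
have /(all_zv j)/hasP[x /flattenP[s /mapP[j0 j0f ->{s}]]] := cover_checkT.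
move=> /flattenP[s /mapP[y yorb ->{s}]] + /Z.eqb_eq jx; rewrite -jx => xy.
have j0r : (0 <= j0 < modulus)%zz.
  have /allP/(_ _ j0f) : all (fun x => (0 <=? x)%zz && (x <? modulus)%zz) frequencies.
    by vm_compute.
  by move=> /andP[/Z.leb_le ? /Z.ltb_lt ?].
suff [i [zi iP]] : exists i : A, zv i = y /\
    forall a, (forall h, a (- h) = a h) -> 0 <= form i a.
  move: xy; rewrite !inE -zi -zvN => /orP[] /eqP/zv_inj ->; first exact: iP.
  exact: form_opp.
have : exists i : A, zv i = j0 /\
    forall a, (forall h, a (- h) = a h) -> 0 <= form i a.
  by exists (zinv j0); rewrite zinvK //; split=> // b; apply: form_frequency; rewrite zinvK.
move: yorb {j0f j0r}; elim: 10%N j0 => [|n IH] z //=; rewrite inE => /orP[/eqP -> //|yo].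
case=> i [zi iP]; apply: IH yo _; exists (zgen * i); split.
  by rewrite zvM zv_zgen zi.
exact: form_gen.
Qed.

Lemma sum_weight_gt : 3%:R * (\sum_h Dr h) < \sum_h \sum_k Wr h k.
Proof.
have sumE (f : Z -> Z) : (forall h, ~~ hdiff h -> f (zv h) = 0%zz) ->
    \sum_h IZR (f (zv h)) = IZR (zsum (map f all_half_diffs)).
  move=> f0; rewrite sum_half => [|h nT]; last by rewrite f0.
  rewrite IZR_zsum big_cat big_map big_split -zv_hdiff_reps !big_map /=.
  by congr (_ + _); apply: eq_bigr => h _; rewrite zvN.
have -> : \sum_h Dr h = IZR (zsum (map diag all_half_diffs)).
  by apply: sumE => h; rewrite negbK => /Z.eqb_eq.
have -> : \sum_h \sum_k Wr h k
    = IZR (zsum (map (fun h => zsum (map (weight h) all_half_diffs)) all_half_diffs)).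
  rewrite -sumE => [|h nT]; last first.
    apply: eq_IZR; rewrite -sumE => [|k _]; last by apply: Wz_supp; rewrite (negbTE nT).
    by apply: big1 => k _; rewrite -/(Wz h k) Wz_supp ?(negbTE nT).
  apply: eq_bigr => h _; rewrite -sumE // => k nT.
  by apply: Wz_supp; rewrite (negbTE nT) andbF.
have /Z.ltb_lt/IZR_lt/RltP := sum_checkT; rewrite mult_IZR.
by congr (_ * _ < _); rewrite -INRE /=; ring.
Qed.

(** * Cliques and colourings of the graph *)

Definition vtx (a : A) : 'I_860 := inord a.

Lemma val_vtx a : val (vtx a) = a.
Proof.
rewrite /= inordK //; apply: leq_trans (ltn_ord a) _.
by apply/ssrnat.leP; move: pE; rewrite /modulus; lia.
Qed.

Lemma vtx_inj : injective vtx.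
Proof. by move=> a b /(congr1 val); rewrite !val_vtx => /val_inj. Qed.

Lemma vtxP (u : 'I_860) : (u < 793)%N -> exists a, u = vtx a.
Proof.
move=> /ssrnat.ltP u793; have up : (u < p.+2)%N.
  by apply/ssrnat.ltP; move: pE; rewrite /modulus; lia.
by exists (Ordinal up); apply: val_inj; rewrite val_vtx.
Qed.

Lemma folkman_adj_vtx a b : folkman_adj (vtx a) (vtx b) = hdiff (inv2 * (a - b)).
Proof.
have lt793 c : (val (vtx c) < 793)%N.
  rewrite val_vtx; apply/ssrnat.ltP; have := zv_range c; rewrite /zv /modulus; lia.
rewrite /folkman_adj !lt793 /hdiff zvM zvB zinvK // /zv.
by rewrite -!val_vtx.
Qed.

Lemma folkman_adjP u v : folkman_adj u v ->
  exists a b, [/\ u = vtx a, v = vtx b & hdiff (inv2 * (a - b))].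
Proof.
move=> uv; have /and3P[/vtxP[a ua] /vtxP[b vb] _] := uv.
by exists a, b; split=> //; rewrite -folkman_adj_vtx -ua -vb.
Qed.

Lemma folkman_sym : symmetric folkman_adj.
Proof.
suff H u v : folkman_adj u v -> folkman_adj v u.
  by move=> u v; apply/idP/idP; apply: H.
move=> /folkman_adjP[a [b [-> -> Tab]]].
by rewrite folkman_adj_vtx -opprB mulrN hdiffN.
Qed.

Lemma folkman_irr : irreflexive folkman_adj.
Proof.
move=> u; apply/negP => uu; have /folkman_adjP[a [b [ua ub]]] := uu.
by rewrite (vtx_inj (etrans (esym ua) ub)) subrr mulr0 hdiff0.
Qed.

Lemma no_K4 (x y z : A) : hdiff x -> hdiff y -> hdiff z ->
  hdiff (y - x) -> hdiff (z - x) -> hdiff (z - y) -> False.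
Proof.
move=> Tx Ty Tz Tyx Tzx Tzy.
have /allP/(_ (zv x)) := clique_checkT; rewrite -hdiffE => /(_ Tx).
move=> /allP/(_ (zv y)); rewrite mem_filter -zvB -hdiffE -/(hdiff _) Tyx Ty => /(_ isT).
move=> /allP/(_ (zv z)); rewrite mem_filter -!zvB -hdiffE -!/(hdiff _) Tzx Tz => /(_ isT).
by rewrite Tzy.
Qed.

Lemma folkman_clique_free : clique_free 4 (SimpleGraph folkman_sym folkman_irr).
Proof.
move=> K cK clK.
have := enum_uniq K; have := cK; rewrite cardE.
have memK u : u \in enum K -> u \in K by rewrite mem_enum.
case: (enum K) memK => [|u1 [|u2 [|u3 [|u4 [|]]]]] //= memK _.
rewrite !inE !negb_or => /and4P[/and3P[n12 n13 n14] /andP[n23 n24] n34 _].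
have E u v : u \in [:: u1; u2; u3; u4] -> v \in [:: u1; u2; u3; u4] -> u != v ->
    folkman_adj u v.
  by move=> uK vK uv; apply: clK => //; apply: memK.
have E12 : folkman_adj u2 u1 by rewrite folkman_sym; apply: E; rewrite ?inE ?eqxx ?orbT.
have E13 : folkman_adj u3 u1 by rewrite folkman_sym; apply: E; rewrite ?inE ?eqxx ?orbT.
have E14 : folkman_adj u4 u1 by rewrite folkman_sym; apply: E; rewrite ?inE ?eqxx ?orbT.
have E23 : folkman_adj u3 u2 by rewrite folkman_sym; apply: E; rewrite ?inE ?eqxx ?orbT.
have E24 : folkman_adj u4 u2 by rewrite folkman_sym; apply: E; rewrite ?inE ?eqxx ?orbT.
have E34 : folkman_adj u4 u3 by rewrite folkman_sym; apply: E; rewrite ?inE ?eqxx ?orbT.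
(* Two disjoint edges already show that none of the four vertices is among the isolated ones. *)
have /folkman_adjP[b [a [ub ua _]]] := E12.
have /folkman_adjP[d [c [ud uc _]]] := E34.
move: E12 E13 E14 E23 E24 E34; rewrite ua ub uc ud !folkman_adj_vtx.
move=> E12 E13 E14 E23 E24 E34.
(* Translating by -a moves the first vertex to 0, as [clique_check] expects. *)
have sub x y : inv2 * (x - a) - inv2 * (y - a) = inv2 * (x - y).
  by rewrite -mulrBr opprB addrA subrK.
by apply: (@no_K4 (inv2 * (b - a)) (inv2 * (c - a)) (inv2 * (d - a))); rewrite ?sub.
Qed.

Lemma folkman_arrows : arrows33 (SimpleGraph folkman_sym folkman_irr).
Proof.
move=> c; apply: Classical_Prop.NNPP => noK.
pose col (h m : A) := c [set vtx (m - h); vtx (m + h)].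
pose y (h m : A) : R := if col h m then 1 else -1.
have yN h m : y (- h) m = y h m by rewrite /y /col opprK setUC.
have y2 h m : y h m ^+ 2 = 1 by rewrite /y; case: ifP; rewrite ?sqrrN expr1n.
have tri h k m : Wr h k != 0 ->
    y h m * y k (m + (h + k)) + y h m * y (h + k) (m + k)
    + y k (m + (h + k)) * y (h + k) (m + k) = -1.
  move=> W0; case: (boolP [&& hdiff h, hdiff k & hdiff (h + k)]) => [/and3P[Th Tk Thk]|nT];
    last by rewrite /Wr Wz_supp ?eqxx in W0.
  set P := vtx (m - h); set Q := vtx (m + h); set S := vtx (m + h + k + k).
  have e1 : col h m = c [set P; Q] by [].
  have e2 : col k (m + (h + k)) = c [set Q; S].
    by rewrite /col !addrA addrK.
  have e3 : col (h + k) (m + k) = c [set P; S].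
    rewrite /col /P /S; congr (c [set vtx _; vtx _]).
      by rewrite opprD addrACA subrr addr0.
    by rewrite addrACA addrA.
  have PQ : folkman_adj P Q.
    by rewrite folkman_adj_vtx opprD addrACA subrr add0r -opprD mulrN hdiffN inv2M.
  have QS : folkman_adj Q S.
    rewrite folkman_adj_vtx.
    have -> : m + h - (m + h + k + k) = - (k + k) by rewrite -(addrA (m + h)) opprD addrA subrr add0r.
    by rewrite mulrN hdiffN inv2M.
  have PS : folkman_adj P S.
    rewrite folkman_adj_vtx.
    have -> : m - h - (m + h + k + k) = - ((h + k) + (h + k)) by ring.
    by rewrite mulrN hdiffN inv2M.
  have nmono : ~ (c [set P; Q] = c [set Q; S] /\ c [set P; Q] = c [set P; S]).
    move=> [c1 c2]; apply: noK; exists [set P; Q; S].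
    have nPQ : P != Q by apply: contraTneq PQ => ->; rewrite folkman_irr.
    have nQS : Q != S by apply: contraTneq QS => ->; rewrite folkman_irr.
    have nPS : P != S by apply: contraTneq PS => ->; rewrite folkman_irr.
    split.
    - by rewrite setUC cardsU1 !inE cards2 nPQ eq_sym (negbTE nPS) eq_sym (negbTE nQS).
    - move=> u v; rewrite !inE => /orP[/orP[]|] /eqP -> /orP[/orP[]|] /eqP ->;
        rewrite ?eqxx //= => _; by rewrite ?PQ ?QS ?PS // folkman_sym.
    - exists (c [set P; Q]).
      move=> u v; rewrite !inE => /orP[/orP[]|] /eqP -> /orP[/orP[]|] /eqP ->;
        rewrite ?eqxx //= => _; by rewrite -?c1 -?c2 // setUC -?c1 -?c2.
  (* Among three signs that are not all equal exactly two agree, so one product is 1 and two are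
     -1. *)
  rewrite /y e1 e2 e3; move: nmono.
  by case: (c [set P; Q]); case: (c [set Q; S]); case: (c [set P; S]) => n;
    rewrite ?mulr1 ?mul1r ?mulrN1 ?opprK; try (by case: n); ring.
suff : \sum_h \sum_k Wr h k <= 3%:R * \sum_h Dr h by rewrite leNgt sum_weight_gt.
apply: (weight_le_of_not_mono chCD chCN chSN sum_chC _ _ _ form_ge0 yN y2 tri).
- by move=> h k; rewrite /Wr WzN.
- by move=> h k; rewrite /Wr Wz_sym.
- by move=> h k; rewrite /Wr Wz_rot.
Qed.

End Residues.

(** * The bound on the Folkman number *)

Lemma folkman_860 : has_folkman_graph 860.
Proof.
have pE : Z.of_nat 791.+2 = modulus by [].
exists 'I_860, (SimpleGraph (folkman_sym pE) (folkman_irr pE)); split.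
- exact: card_ord.
- exact: folkman_clique_free.
- exact: folkman_arrows.
Qed.

Theorem theorem2 :
  (exists N : nat, is_Fe334 N /\ N <= 860) /\ has_folkman_graph 860.
Proof.
split; last exact: folkman_860.
(* A least order exists by strong induction; whether a smaller order has a Folkman graph is decided
   classically. *)
suff H n : has_folkman_graph n -> exists N, is_Fe334 N /\ N <= n.
  exact: H folkman_860.
elim/ltn_ind: n => n IH Hn.
case: (Classical_Prop.classic (exists2 m, has_folkman_graph m & m < n)).
  move=> [m Hm mn]; have [N [HN Nm]] := IH m mn Hm.
  by exists N; split=> //; apply: leq_trans Nm (ltnW mn).
move=> nomin; exists n; split=> //; split=> // m Hm.
by rewrite leqNgt; apply/negP => mn; apply: nomin; exists m.
Qed.
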